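(* Assume $G$ satisfies the Plausibility Assumption. Let $S$ be a set of variables and let $H\supseteq\mathrm{cl}(S)$ be a small subgraph of $G$. Then the marginal of $\eta_H$ on the coordinates in $S$ equals the marginal of $\eta_{\mathrm{cl}(S)}$ on the coordinates in $S$.
   Context: Fix a finite alphabet $\Omega$ with $|\Omega|=q\ge2$, integers $K\ge3$ and $3\le\tau\le K$. $G$ is a bipartite factor graph between variable-vertices $[n]$ and constraint-vertices; each constraint-vertex $f$ has an ordered neighbourhood $N(f)$ with $\tau-1\le|N(f)|\le K$ and a $(\tau-1)$-wise uniform distribution $\mu_f$ on $\Omega^{N(f)}$ (marginal on every $\tau-1$ coordinates uniform). A subgraph is an edge-induced subgraph $H=G[A]$ (possibly empty, not necessarily connected); $\mathrm{vbls}(H),\mathrm{cons}(H)$ are its variable-/constraint-vertices, $N_H(f)$ the variables adjacent to $f$ in $H$. $H$ is a $\tau$-subgraph if $|N_H(f)|\ge\tau$ for all $f\in\mathrm{cons}(H)$; a leaf is a variable-vertex of degree $1$ in $H$. Parameters $1\le\mathrm{SMALL}\le n/2$, $0<\zeta<1$, $K\le\zeta\cdot\mathrm{SMALL}$; $H$ is small if $|\mathrm{cons}(H)|\le\mathrm{SMALL}$. For a $\tau$-subgraph $H$: credits $=$ number of leaves; debits $=\sum_{i}\max(\deg_H(i)-2,0)+\sum_{f}(|N_H(f)|-\tau)$; revenue $R(H)=$ credits $-$ debits; income $I(H)=R(H)-\zeta|\mathrm{cons}(H)|$; plausible means $I(H)\ge0$. Plausibility Assumption: every $\tau$-subgraph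 with at most $2\cdot\mathrm{SMALL}$ constraint-vertices is plausible. For a set $S$ of variables, $H$ is $S$-closed if it is a $\tau$-subgraph all of whose leaves lie in $S$; $\mathrm{cl}(S)$ is the union of all small $S$-closed $\tau$-subgraphs. Planted distribution: for a small subgraph $H$, $\eta_H$ is the distribution on $\Omega^n$ obtained by drawing independently $w_f\sim\mu_f$ for each $f\in\mathrm{cons}(H)$, regarding $w_{f,i}$ ($i\in N_H(f)$) as the value suggested for variable $i$ by $f$, conditioning on the event that for every $i\in\mathrm{vbls}(H)$ all values suggested to $i$ coincide and setting $x_i$ to that common value, and choosing $x_i$ for $i\notin\mathrm{vbls}(H)$ independently uniformly from $\Omega$. *)

(* Defs.v *)
From mathcomp Require Import all_boot all_order all_algebra.
Set Implicit Arguments.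
Unset Strict Implicit.
Unset Printing Implicit Defensive.
Import Order.TTheory GRing.Theory Num.Theory.
Local Open Scope ring_scope.

Section Distributions.
Variables (R : realFieldType) (I Omega : finType).

Definition is_dist (p : {ffun I -> Omega} -> R) : Prop :=
  (forall w, 0 <= p w) /\ \sum_w p w = 1.

Definition marginal (p : {ffun I -> Omega} -> R) (T : {set I})
    (y : {ffun {i : I | i \in T} -> Omega}) : R :=
  \sum_(x : {ffun I -> Omega} | [forall i, x (val i) == y i]) p x.

Definition wise_uniform (k : nat) (p : {ffun I -> Omega} -> R) : Prop :=
  forall T : {set I}, #|T| = k ->
  forall y, marginal p (T := T) y = (#|Omega|%:R ^+ k)^-1.

End Distributions.

Arguments marginal {R I Omega} p T y.

(* The variable-vertices are 'I_n and the constraint-vertices are F.  The type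
   seq_sub (nbr f) is the set of variables occurring in the ordered
   neighbourhood nbr f, so mu f lives on Omega^N(f). *)
Record factor_graph (R : realFieldType) (Omega : finType) (K tau n : nat)
    (F : finType) := FactorGraph {
  nbr : F -> seq 'I_n;
  nbr_uniq : forall f, uniq (nbr f);
  nbr_size : forall f, (tau - 1 <= size (nbr f) <= K)%N;
  mu : forall f, {ffun seq_sub (nbr f) -> Omega} -> R;
  mu_dist : forall f, is_dist (@mu f);
  mu_uniform : forall f, wise_uniform (tau - 1) (@mu f)
}.

(* An edge-induced subgraph G[A] is represented by its edge set A, an edge
   being a pair (variable, constraint). *)
Section EdgeSets.
Variables (n : nat) (F : finType).
Implicit Type H : {set 'I_n * F}.

Definition vbls H : {set 'I_n} := [set e.1 | e in H].
Definition constraints H : {set F} := [set e.2 | e in H].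
Definition nbr_in H (f : F) : {set 'I_n} := [set i | (i, f) \in H].
Definition deg H (i : 'I_n) : nat := #|[set f | (i, f) \in H]|.
Definition leaves H : {set 'I_n} := [set i in vbls H | deg H i == 1%N].

End EdgeSets.

Section Plausibility.
Variables (R : realFieldType) (Omega : finType) (K tau n : nat) (F : finType).
Variable G : factor_graph R Omega K tau n F.
Variables (SMALL zeta : R).
Implicit Type H : {set 'I_n * F}.

Definition edges : {set 'I_n * F} := [set e | e.1 \in nbr G e.2].

Definition subgraph H : bool := H \subset edges.

Definition tau_subgraph H : bool :=
  subgraph H && [forall f in constraints H, (tau <= #|nbr_in H f|)%N].

Definition small H : bool := #|constraints H|%:R <= SMALL.

Definition credits H : R := #|leaves H|%:R.

Definition debits H : R :=
  \sum_(i in vbls H) Num.max ((deg H i)%:R - 2) 0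
  + \sum_(f in constraints H) (#|nbr_in H f|%:R - tau%:R).

Definition revenue H : R := credits H - debits H.

Definition income H : R := revenue H - zeta * #|constraints H|%:R.

Definition plausible H : bool := 0 <= income H.

Definition plausibility_assumption : Prop :=
  forall H, tau_subgraph H -> #|constraints H|%:R <= 2 * SMALL -> plausible H.

Definition S_closed (S : {set 'I_n}) H : bool :=
  tau_subgraph H && (leaves H \subset S).

Definition cl (S : {set 'I_n}) : {set 'I_n * F} :=
  \bigcup_(H : {set 'I_n * F} | small H && S_closed S H) H.

End Plausibility.

Section Planted.
Variables (R : realFieldType) (Omega : finType) (K tau n : nat) (F : finType).
Variable G : factor_graph R Omega K tau n F.
Variable H : {set 'I_n * F}.

Definition draw :=
  {dffun forall f : {f : F | f \in constraints H},
     {ffun seq_sub (nbr G (val f)) -> Omega}}.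

Definition draw_pr (w : draw) : R :=
  \prod_(f : {f : F | f \in constraints H}) mu (w f).

(* Only the edges of H carry a suggestion: w f may also have coordinates in
   N(f) outside N_H(f), which are ignored. *)
Definition suggests (w : draw) (i : 'I_n) (a : Omega) : bool :=
  [exists f, exists j : seq_sub (nbr G (val f)),
     [&& val j == i, (i, val f) \in H & w f j == a]].

Definition coincide (w : draw) : bool :=
  [forall i in vbls H, forall a, forall b,
     suggests w i a && suggests w i b ==> (a == b)].

Definition coincide_pr : R := \sum_(w | coincide w) draw_pr w.

(* The probability of x given draws w that coincide: x is forced on vbls H and
   uniform on the other variables. *)
Definition extension_pr (w : draw) (x : {ffun 'I_n -> Omega}) : R :=
  if [forall i in vbls H, suggests w i (x i)]
  then (#|Omega|%:R ^+ #|~: vbls H|)^-1 else 0.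

(* This is the planted distribution as soon as 0 < coincide_pr; otherwise the
   conditioning is meaningless and the value is 0. *)
Definition planted (x : {ffun 'I_n -> Omega}) : R :=
  \sum_(w | coincide w) draw_pr w / coincide_pr * extension_pr w x.

End Planted.

(* Main.v *)
(* Up to a constant, the planted weight of x is the product over f of the
   densities of the marginals of mu_f on N_H(f) relative to the uniform
   distribution.  If a constraint has fewer than tau neighbours in H then its
   density is 1 and it can be deleted; if i is a leaf of H outside S then summing
   over x_i deletes its edge.  Neither step changes the (unnormalized)
   S-marginal, and neither removes an edge of an S-closed subgraph of H, so the
   peeling stops exactly at cl(S).  For S empty, plausibility makes cl(S) empty,
   which shows that the total mass is that of the empty subgraph. *)

Require Import Defs.
From mathcomp Require Import all_boot all_order all_algebra.
Set Implicit Arguments.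
Unset Strict Implicit.
Unset Printing Implicit Defensive.
Import Order.TTheory GRing.Theory Num.Theory.
Local Open Scope ring_scope.

(** Distributivity for dependent families. It serves to factor a sum over draws into one sum per
    constraint; the passage through [fprod] reduces it to tagged, non-dependent functions. *)
Lemma sum_dffun_prod (R : comNzRingType) (I : finType) (T_ : I -> finType)
    (g : forall i, T_ i -> R) :
  \sum_(w : {dffun forall i, T_ i}) \prod_i g i (w i)
  = \prod_i \sum_(a : T_ i) g i a.
Proof.
pose P_ i : {ffun T_ i -> R} := [ffun a => g i a].
transitivity (\sum_(t : fprod T_) \prod_(i in I) P_ i (t i)).
  rewrite (reindex (@dffun_of_fprod _ T_)) /=; last first.
    exact/onW_bij/dffun_of_fprod_bij.
  by apply: eq_bigr => t _; apply: eq_bigr => i _; rewrite !ffunE.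
rewrite big_fprod -(bigA_distr_big_dep (fun i => tagged_with T_ i)
  (fun i => untag 0 (P_ i))).
apply: eq_bigr => i _; rewrite -(big_tag (fun i a => P_ i a)).
by apply: eq_bigr => a _; rewrite ffunE.
Qed.

(** * Changing one coordinate of an assignment *)

Section Update.
Variables (R : comNzRingType) (I Omega : finType).
Implicit Types (x : {ffun I -> Omega}) (i : I) (a : Omega).

Definition upd x i a : {ffun I -> Omega} :=
  [ffun j => if j == i then a else x j].

Lemma upd_same x i a : upd x i a i = a.
Proof. by rewrite ffunE eqxx. Qed.

Lemma upd_other x i a j : j != i -> upd x i a j = x j.
Proof. by rewrite ffunE => /negPf->. Qed.

(* [(x, a) |-> (upd x i a, x i)] is an involution. *)
Lemma sum_upd (g : {ffun I -> Omega} -> R) i :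
  \sum_x \sum_a g (upd x i a) = #|Omega|%:R * \sum_x g x.
Proof.
rewrite mulr_natl -sumrMnl.
rewrite (pair_bigA _ (fun x a => g (upd x i a))) /=.
pose s (p : {ffun I -> Omega} * Omega) := (upd p.1 i p.2, p.1 i).
have sK : involutive s.
  move=> [x a]; rewrite /s /= upd_same; congr pair.
  by apply/ffunP=> j; rewrite !ffunE; case: eqP => // ->.
rewrite (reindex_inj (inv_inj sK)) /=.
transitivity (\sum_(p : {ffun I -> Omega} * Omega) g p.1).
  by apply: eq_bigr => p _; have /(congr1 fst) /= -> := sK p.
rewrite -(pair_bigA _ (fun x (_ : Omega) => g x)) /=.
by apply: eq_bigr => x _; rewrite sumr_const.
Qed.

End Update.

(** * Densities of constraints and weights of subgraphs *)

Section Weight.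
Variables (R : realFieldType) (Omega : finType) (K tau n : nat) (F : finType).
Variable G : factor_graph R Omega K tau n F.
Hypothesis Omega_gt0 : (0 < #|Omega|)%N.
Implicit Types (H L : {set 'I_n * F}) (S T : {set 'I_n}) (f : F) (i : 'I_n).
Implicit Types (x : {ffun 'I_n -> Omega}) (a : Omega).

Let q : R := #|Omega|%:R.

Let q_gt0 : 0 < q.
Proof. by rewrite /q ltr0n. Qed.

Let q_neq0 : q != 0.
Proof. exact: lt0r_neq0. Qed.

Definition agrees f T (w : {ffun seq_sub (nbr G f) -> Omega}) x : bool :=
  [forall j, (val j \in T) ==> (w j == x (val j))].

(** For [T] inside [nbr G f], the density of the [T]-marginal of [mu f] against the uniform one. The
    argument is a full assignment so that [T] can vary without changing its type. *)
Definition density f T x : R := q ^+ #|T| * \sum_(w | @agrees f T w x) mu w.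

(** All of [F] indexes the product: constraints outside [H] contribute 1 by [density_set0], so
    deletions leave the index set alone. *)
Definition weight H x : R := \prod_f density f (nbr_in H f) x.

Lemma density_set0 f x : density f set0 x = 1.
Proof.
rewrite /density cards0 expr0 mul1r.
have [_ <-] := @mu_dist _ _ _ _ _ _ G f.
by apply: eq_bigl => w; apply/forallP => j; rewrite inE.
Qed.

Lemma density_upd f T x i a : i \notin T -> density f T (upd x i a) = density f T x.
Proof.
move=> iT; congr (_ * _); apply: eq_bigl => w.
apply: eq_forallb => j; case: (boolP (val j \in T)) => //= jT.
by rewrite upd_other //; apply: contraNneq iT => <-.
Qed.

(** Summing out coordinate [i] of a marginal gives the marginal on [T :\ i]; the factor [q] comes
    from the normalization losing one coordinate. *)
Lemma sum_density_upd f T x i : i \in T -> i \in nbr G f ->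
  \sum_a density f T (upd x i a) = q * density f (T :\ i) x.
Proof.
move=> iT iN; rewrite /density -mulr_sumr (cardsD1 i) iT exprS -mulrA.
congr (_ * (_ * _)).
pose j0 : seq_sub (nbr G f) := SeqSub iN.
(* The tables agreeing with [x] off [i] are split by their value at [i], which plays the role of
   [a]. *)
rewrite [RHS](partition_big
  (fun w : {ffun seq_sub (nbr G f) -> Omega} => w j0) predT) //=.
apply: eq_bigr => a _; apply: eq_bigl => w.
apply/forallP/andP => [h|[/forallP h /eqP wa] j].
  split; last by have := h j0; rewrite /= iT upd_same.
  apply/forallP => j; apply/implyP; rewrite !inE => /andP[ji jT].
  by have := h j; rewrite jT upd_other.
apply/implyP => jT; have [ji|ji] := eqVneq (val j) i.
  have -> : j = j0 by apply: val_inj.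
  by rewrite upd_same wa.
by rewrite upd_other //; have := h j; rewrite !inE ji jT.
Qed.

Lemma density_wise_uniform f T x :
  {subset T <= nbr G f} -> #|T| = (tau - 1)%N -> density f T x = 1.
Proof.
move=> TN cT; pose T' : {set seq_sub (nbr G f)} := [set j | val j \in T].
have cT' : #|T'| = (tau - 1)%N.
  rewrite -cT -(card_imset (mem T') val_inj); apply: eq_card => i.
  apply/imsetP/idP => [[j jT ->]|iT]; first by move: jT; rewrite inE.
  by exists (SeqSub (TN _ iT)); rewrite ?inE.
pose y : {ffun {j | j \in T'} -> Omega} := [ffun j => x (val (val j))].
have := @mu_uniform _ _ _ _ _ _ G f T' cT' y.
rewrite /marginal /density cT => E.
rewrite -[RHS](@mulfV _ (q ^+ (tau - 1))) ?expf_neq0 // -E.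
congr (_ * _); apply: eq_bigl => w.
apply/forallP/forallP => h j.
  by rewrite ffunE; have := h (val j); have := valP j; rewrite inE => ->.
apply/implyP => jT; have jT' : j \in T' by rewrite inE.
by have := h (exist _ j jT'); rewrite ffunE.
Qed.

(** Induction on the deficit [tau - 1 - #|T|]: the density on [T] is the average over [a] of the
    density on [T] with one more variable, and that one is constantly 1. *)
Lemma density_lt_tau f T x :
  {subset T <= nbr G f} -> (#|T| <= tau - 1)%N -> density f T x = 1.
Proof.
move=> + leT; move: {2}(tau - 1 - #|T|)%N (erefl (tau - 1 - #|T|)%N) => m.
elim: m T leT x => [|m IHm] T leT x.
  by move/eqP; rewrite subn_eq0 => geT TN; apply: density_wise_uniform => //;
     apply/eqP; rewrite eqn_leq leT.
move=> Em TN; have ltT : (#|T| < tau - 1)%N by rewrite -subn_gt0 Em.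
(* A fresh variable exists since [nbr G f] has at least [tau - 1] elements. *)
have [i iN iT] : exists2 i, i \in nbr G f & i \notin T.
  apply/hasP; apply: contraTT ltT => /hasPn h; rewrite -leqNgt.
  have /andP[/leq_trans-> //] := nbr_size G f.
  rewrite -(card_uniqP (nbr_uniq G f)); apply: subset_leq_card.
  by apply/subsetP => i /h; rewrite negbK.
have := sum_density_upd x (setU11 i T) iN; rewrite setU1K // => E.
apply: (mulfI q_neq0); rewrite -E mulr1.
have -> : q = \sum_(a : Omega) 1 by rewrite sumr_const.
apply: eq_bigr => a _; apply: IHm; rewrite ?cardsU1 ?iT //.
  by rewrite add1n subnS Em.
by move=> j /setU1P[->|/TN].
Qed.

(** * Peeling off light constraints and leaves *)

Lemma nbr_in_sub H f : subgraph G H -> {subset nbr_in H f <= nbr G f}.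
Proof. by move=> /subsetP sH i; rewrite inE => /sH; rewrite inE. Qed.

(* Stated with an arbitrary test function [P] so that it covers both the
   S-marginal and, for [P = 1], the total mass. *)
Lemma weight_sum_del_leaf H (P : {ffun 'I_n -> Omega} -> R) i f :
  subgraph G H -> (i, f) \in H -> deg H i = 1%N ->
  (forall x a, P (upd x i a) = P x) ->
  \sum_x P x * weight H x = \sum_x P x * weight (H :\ (i, f)) x.
Proof.
(* After multiplication by [q], the left side also sums over a new value [a] for coordinate [i], and
   the two sides match for each [x] separately. *)
move=> sH eH dH PU; apply: (mulfI q_neq0); rewrite -(sum_upd _ i) mulr_sumr.
apply: eq_bigr => x _.
have [g dg] : exists g, [set f | (i, f) \in H] = [set g] by apply/cards1P/eqP.
have fg : f = g by apply/set1P; rewrite -dg inE.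
(* Since [i] is a leaf, only the factor of [f] sees its value. *)
have iN f' : f' != f -> i \notin nbr_in H f'.
  by apply: contraNN; have/setP/(_ f') := dg; rewrite fg !inE => ->.
under eq_bigr => a _ do rewrite PU /weight (bigD1 f) //=.
rewrite /weight [in RHS](bigD1 f) //=.
have -> : nbr_in (H :\ (i, f)) f = nbr_in H f :\ i.
  by apply/setP => j; rewrite !inE xpair_eqE eqxx andbT.
have iH : i \in nbr_in H f by rewrite inE.
rewrite mulrCA [q * (_ * _)]mulrA -sum_density_upd //; last exact: nbr_in_sub iH.
rewrite mulr_suml mulr_sumr; apply: eq_bigr => a _; congr (_ * (_ * _)).
apply: eq_bigr => f' f'f; rewrite density_upd ?iN //; congr density.
by apply/setP => j; rewrite !inE xpair_eqE (negPf f'f) andbF.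
Qed.

Lemma weight_del_constraint H f x :
  subgraph G H -> (#|nbr_in H f| < tau)%N ->
  weight H x = weight [set e in H | e.2 != f] x.
Proof.
move=> sH lt; apply: eq_bigr => f' _; have [->|ne] := eqVneq f' f.
  have -> : nbr_in [set e in H | e.2 != f] f = set0.
    by apply/setP => j; rewrite !inE /= eqxx andbF.
  rewrite density_set0 density_lt_tau //; first exact: nbr_in_sub.
  (* [lt] excludes [tau = 0], where the truncated [tau - 1] would be off. *)
  by case: tau lt => // t; rewrite subn1.
by congr density; apply/setP => j; rewrite !inE /= ne andbT.
Qed.

Lemma constraints_sub H L : H \subset L -> constraints H \subset constraints L.
Proof. exact: imsetS. Qed.

Lemma mem_constraints H i f : (i, f) \in H -> f \in constraints H.
Proof. by move=> h; apply/imsetP; exists (i, f). Qed.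

Lemma mem_vbls H i f : (i, f) \in H -> i \in vbls H.
Proof. by move=> h; apply/imsetP; exists (i, f). Qed.

Lemma small_sub (SMALL : R) H L : H \subset L -> small SMALL L -> small SMALL H.
Proof.
move=> HL; apply: le_trans; rewrite ler_nat subset_leq_card //.
exact: constraints_sub.
Qed.

(** Were the edge in [L], then [i] would have degree exactly 1 there too, a leaf of [L] outside
    [S]. *)
Lemma S_closed_del_leaf S L H i f :
  S_closed G S L -> L \subset H -> deg H i = 1%N -> i \notin S ->
  L \subset H :\ (i, f).
Proof.
move=> /andP[_ lS] LH dH iS; rewrite subsetD1 LH /=.
apply: contra iS => eL; apply: (subsetP lS); rewrite !inE (mem_vbls eL) /=.
rewrite eqn_leq -{1}dH subset_leq_card /=.
  by rewrite card_gt0; apply/set0Pn; exists f; rewrite inE.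
by apply/subsetP => g; rewrite !inE => /(subsetP LH).
Qed.

(** An edge of [L] at [f] would force at least [tau] neighbours of [f] in [L], hence in [H]. *)
Lemma S_closed_del_constraint S L H f :
  S_closed G S L -> L \subset H -> (#|nbr_in H f| < tau)%N ->
  L \subset [set e in H | e.2 != f].
Proof.
move=> /andP[/andP[_ /forall_inP tL] _] LH lt.
apply/subsetP => -[i g] eL; rewrite inE (subsetP LH) //=.
apply: contraTneq lt => <-; rewrite -leqNgt.
apply: leq_trans (tL _ (mem_constraints eL)) _; apply: subset_leq_card.
by apply/subsetP => j; rewrite !inE => /(subsetP LH).
Qed.

(** Induction on the number of edges. Each deletion keeps every small [S]-closed subgraph, hence
    their union. *)
Lemma weight_sum_cl (SMALL : R) S H (P : {ffun 'I_n -> Omega} -> R) :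
  (forall x i a, i \notin S -> P (upd x i a) = P x) ->
  subgraph G H -> small SMALL H -> cl G SMALL S \subset H ->
  \sum_x P x * weight H x = \sum_x P x * weight (cl G SMALL S) x.
Proof.
move=> PU; have [m] := ubnP #|H|.
elim: m H => // m IHm H leH sH smH clH.
have sub_cl L : small SMALL L -> S_closed G S L -> L \subset H.
  move=> smL cL; apply: subset_trans clH.
  by apply: (bigcup_sup L); rewrite ?smL.
have step H' : H' \proper H ->
    (forall L, S_closed G S L -> L \subset H -> L \subset H') ->
    \sum_x P x * weight H x = \sum_x P x * weight H' x ->
    \sum_x P x * weight H x = \sum_x P x * weight (cl G SMALL S) x.
  move=> pH' hL ->; have sH' := proper_sub pH'; apply: IHm.
  - exact: leq_trans (proper_card pH') _.
  - exact: subset_trans sH.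
  - exact: small_sub smH.
  - by apply/bigcupsP => L /andP[smL cL]; apply: hL => //; apply: sub_cl.
(* When peeling is stuck, [H] is itself small and [S]-closed, so it is a member of the union. *)
have [cH|] := boolP (S_closed G S H).
  suff -> : cl G SMALL S = H by [].
  by apply/eqP; rewrite eqEsubset clH; apply: (bigcup_sup H); rewrite ?smH.
rewrite /S_closed /tau_subgraph sH /= negb_and => /orP[].
  case/forall_inPn => f /imsetP[[i g] eH /= ->]; rewrite -ltnNge => lt.
  apply: (step [set e in H | e.2 != g]).
  - rewrite properE; apply/andP; split.
      by apply/subsetP => e; rewrite inE => /andP[].
    by apply/subsetPn; exists (i, g); rewrite ?inE //= eqxx andbF.
  - by move=> L cL LH; apply: S_closed_del_constraint cL LH lt.
  - by apply: eq_bigr => x _; rewrite (weight_del_constraint _ sH lt).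
case/subsetPn => i; rewrite inE => /andP[/imsetP[[i' f] eH /= ->]] /eqP dH iS.
apply: (step (H :\ (i', f))).
- exact: properD1.
- by move=> L cL LH; apply: S_closed_del_leaf cL LH dH iS.
- by apply: weight_sum_del_leaf => // x a; apply: PU.
Qed.

(** * Total mass, from plausibility *)

Lemma weight_set0 x : weight set0 x = 1.
Proof.
apply: big1 => f _; rewrite -[RHS](density_set0 f x); congr density.
by apply/setP => j; rewrite !inE.
Qed.

(** Without leaves there are no credits, and debits are nonnegative, so income is at most [- zeta]
    times the number of constraints; plausibility leaves no constraint, hence no edge. *)
Lemma cl_set0 (SMALL zeta : R) :
  0 <= SMALL -> 0 < zeta -> plausibility_assumption G SMALL zeta ->
  cl G SMALL set0 = set0.
Proof.
move=> SM0 z0 hp; apply/eqP; rewrite -subset0.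
apply/bigcupsP => L /andP[smL /andP[tL]]; rewrite subset0 => /eqP lL.
have /(hp _ tL) : #|constraints L|%:R <= 2 * SMALL.
  by apply: le_trans smL _; rewrite mulr_natl mulr2n lerDl.
rewrite /plausible /income /revenue /credits lL cards0 sub0r -opprD oppr_ge0.
have d0 : 0 <= debits R tau L.
  apply: addr_ge0; apply: sumr_ge0.
    by move=> i _; rewrite le_max lexx orbT.
  move=> f fL; rewrite subr_ge0 ler_nat.
  by case/andP: tL => _ /forall_inP/(_ f fL).
move=> le0; rewrite subset0; apply/set0Pn => -[[i f] eL].
have c0 : (0 < #|constraints L|)%N.
  by apply/card_gt0P; exists f; apply: mem_constraints eL.
by move: le0; rewrite leNgt ltr_wpDl // mulr_gt0 // ltr0n.
Qed.

(** Because the value does not depend on [H], the planted distributions of [H] and of its closure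
    share one positive normalization. *)
Lemma weight_sum1 (SMALL zeta : R) H :
  0 <= SMALL -> 0 < zeta -> plausibility_assumption G SMALL zeta ->
  subgraph G H -> small SMALL H -> \sum_x weight H x = q ^+ n.
Proof.
move=> SM0 z0 hp sH smH; have c0 := cl_set0 SM0 z0 hp.
have := @weight_sum_cl SMALL set0 H (fun=> 1) (fun _ _ _ _ => erefl) sH smH.
rewrite c0 sub0set => /(_ isT).
under eq_bigr do rewrite mul1r.
under [in RHS]eq_bigr do rewrite mul1r weight_set0.
by move=> ->; rewrite sumr_const card_ffun card_ord natrX.
Qed.

(** * From planted distributions to weights *)

Section PlantedWeight.
Variable H : {set 'I_n * F}.
Hypothesis sH : subgraph G H.
Implicit Type w : draw G H.

Definition draw_agrees w x : bool :=
  [forall f, agrees (nbr_in H (val f)) (w f) x].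

(** Every variable of [H] receives some suggestion, so coinciding on [x] means that each constraint
    agrees with [x]; this condition factors over constraints. *)
Lemma draw_agreesP w x :
  draw_agrees w x = coincide w && [forall i in vbls H, suggests w i (x i)].
Proof.
apply/forallP/andP => [h|[/forall_inP co /forall_inP su] f].
  have sug i a : suggests w i a -> a = x i.
    case/existsP => f /existsP[j /and3P[/eqP ji iH /eqP <-]].
    have /forallP/(_ j) := h f; rewrite inE ji iH => /eqP //.
  split; apply/forall_inP => i.
    move=> _; apply/forallP => a; apply/forallP => b.
    by apply/implyP => /andP[/sug-> /sug->].
  case/imsetP => -[i' f] eH /= ->.
  apply/existsP; exists (exist _ f (mem_constraints eH)).
  have iN : i' \in nbr G f by have := subsetP sH _ eH; rewrite inE.
  apply/existsP; exists (SeqSub iN); rewrite /= eqxx eH /=.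
  have /forallP/(_ (SeqSub iN)) := h (exist _ f (mem_constraints eH)).
  by rewrite /= inE eH.
apply/forallP => j; apply/implyP; rewrite inE => eH.
have /forallP/(_ (w f j))/forallP/(_ (x (val j)))/implyP := co _ (mem_vbls eH).
apply; rewrite su ?(mem_vbls eH) // andbT.
by apply/existsP; exists f; apply/existsP; exists j; rewrite !eqxx eH.
Qed.

(** The first factor is the uniform choice off [vbls H]; the second undoes the powers of [q] in the
    densities, whose exponents add up to [#|H|]. *)
Let c : R := (q ^+ #|~: vbls H|)^-1 * (q ^+ #|H|)^-1.

Lemma card_edges : (\sum_(f in constraints H) #|nbr_in H f| = #|H|)%N.
Proof.
rewrite -sum1_card (partition_big (fun e => e.2) (mem (constraints H))) /=.
  apply: eq_bigr => f _; rewrite -sum1_card.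
  rewrite (reindex_onto (fun i => (i, f)) (fun e => e.1)) /=.
    by apply: eq_bigl => i; rewrite !inE !eqxx !andbT.
  by move=> [i g] /andP[_ /eqP /= ->].
by move=> [i f]; apply: mem_constraints.
Qed.

Lemma sum_draw_agrees x :
  \sum_(w | draw_agrees w x) draw_pr w = (q ^+ #|H|)^-1 * weight H x.
Proof.
(* Encoding disagreement as the value 0 makes the restricted sum a full one, which factors. *)
pose g (f : {f | f \in constraints H}) (u : {ffun seq_sub (nbr G (val f)) -> Omega}) : R :=
  if agrees (nbr_in H (val f)) u x then mu u else 0.
transitivity (\sum_(w : draw G H) \prod_f g f (w f)).
  rewrite big_mkcond; apply: eq_bigr => w _; case: ifPn => [/forallP h|].
    by apply: eq_bigr => f _; rewrite /g h.
  by case/forallPn => f hf; rewrite (bigD1 f) //= /g (negPf hf) mul0r.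
have -> : weight H x = \prod_(f in constraints H) density f (nbr_in H f) x.
  rewrite [RHS]big_mkcond; apply: eq_bigr => f _; case: ifPn => // fH.
  rewrite -[RHS](density_set0 f x); congr density.
  apply/setP => j; rewrite !inE; apply: contraNF fH; exact: mem_constraints.
rewrite sum_dffun_prod /density big_split /= prodrXr card_edges mulKf ?expf_neq0 //.
rewrite [RHS](big_sub (mem (constraints H))) /=.
by apply: eq_bigr => f _; rewrite -big_mkcond.
Qed.

Lemma sum_coincide_extension x :
  \sum_(w : draw G H | coincide w) draw_pr w * extension_pr w x = c * weight H x.
Proof.
rewrite -mulrA -sum_draw_agrees mulr_sumr big_mkcond [in RHS]big_mkcond /=.
apply: eq_bigr => w _; rewrite draw_agreesP /extension_pr.
by case: (coincide w) => //=; case: ifP; rewrite ?mulr0 // mulrC.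
Qed.

(** A coinciding draw fixes exactly one value on each variable of [H] and leaves the others free, so
    the assignments counted match the normalization. *)
Lemma sum_extension w : coincide w -> \sum_x extension_pr w x = 1.
Proof.
move=> /forall_inP co; rewrite /extension_pr -big_mkcond sumr_const.
pose Q i := [pred a | (i \in vbls H) ==> suggests w i a].
have -> : #|[pred x : {ffun 'I_n -> Omega} | [forall i in vbls H, suggests w i (x i)]]|
          = (\prod_i #|Q i|)%N.
  have := card_family Q; rewrite foldrE big_image /= => <-.
  by apply: eq_card => x; rewrite !inE.
have -> : (\prod_i #|Q i| = #|Omega| ^ #|~: vbls H|)%N.
  rewrite (bigID (mem (vbls H))) /= big1 ?mul1n => [|i iH].
    rewrite -prod_nat_const; apply: eq_big => [i|i iH]; rewrite ?inE //.
    by apply: eq_card => a; rewrite !inE (negPf iH).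
  have [a ha] : exists a, suggests w i a.
    case/imsetP: iH => -[i' f] eH /= ->.
    have iN : i' \in nbr G f by have := subsetP sH _ eH; rewrite inE.
    exists (w (exist _ f (mem_constraints eH)) (SeqSub iN)).
    apply/existsP; exists (exist _ f (mem_constraints eH)).
    by apply/existsP; exists (SeqSub iN); rewrite /= !eqxx eH.
  rewrite -(card1 a); apply: eq_card => b; rewrite !inE iH /=.
  apply/idP/eqP => [hb|-> //].
  have /forallP/(_ b)/forallP/(_ a) := co _ iH.
  by rewrite hb ha => /eqP.
by rewrite -(mulr_natr _ (_ ^ _)) natrX mulVf // expf_neq0.
Qed.

(** Insert the total mass 1 of [extension_pr w] for each coinciding [w] and exchange the sums. *)
Lemma coincide_prE : coincide_pr G H = c * \sum_x weight H x.
Proof.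
rewrite mulr_sumr; under eq_bigr do rewrite -sum_coincide_extension.
rewrite exchange_big /=; apply: eq_bigr => w cw.
by rewrite -mulr_sumr sum_extension ?mulr1.
Qed.

Let c_gt0 : 0 < c.
Proof. by rewrite mulr_gt0 // invr_gt0 exprn_gt0. Qed.

Lemma plantedE x : planted G H x = weight H x / \sum_x weight H x.
Proof.
rewrite /planted coincide_prE.
under eq_bigr do rewrite mulrAC.
rewrite -mulr_suml sum_coincide_extension invfM mulrACA mulfV ?mul1r //.
exact: lt0r_neq0.
Qed.

Lemma coincide_pr_gt0 : 0 < \sum_x weight H x -> 0 < coincide_pr G H.
Proof. by rewrite coincide_prE => /(mulr_gt0 c_gt0). Qed.

End PlantedWeight.

End Weight.

Theorem theorem5p12 (R : realFieldType) (Omega : finType) (K tau n : nat)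
    (F : finType) (G : factor_graph R Omega K tau n F) (SMALL zeta : R)
    (hOmega : (2 <= #|Omega|)%N) (hK : (3 <= K)%N) (htau : (3 <= tau <= K)%N)
    (hSMALL : 1 <= SMALL <= n%:R / 2) (hzeta : 0 < zeta < 1)
    (hKSMALL : K%:R <= zeta * SMALL)
    (hplausible : plausibility_assumption G SMALL zeta)
    (S : {set 'I_n}) (H : {set 'I_n * F})
    (hH : subgraph G H) (hsmall : small SMALL H)
    (hcl : cl G SMALL S \subset H) :
  [/\ 0 < coincide_pr G H,
      0 < coincide_pr G (cl G SMALL S) &
      marginal (planted G H) S =1 marginal (planted G (cl G SMALL S)) S].
Proof.
have Omega_gt0 : (0 < #|Omega|)%N by apply: ltn_trans hOmega.
have SM0 : 0 <= SMALL by case/andP: hSMALL => /(le_trans ler01).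
have z0 : 0 < zeta by case/andP: hzeta.
have hC : subgraph G (cl G SMALL S) := subset_trans hcl hH.
have sC : small SMALL (cl G SMALL S) := small_sub hcl hsmall.
have mass L := @weight_sum1 _ _ _ _ _ _ G Omega_gt0 SMALL zeta L SM0 z0 hplausible.
have qn0 : 0 < #|Omega|%:R ^+ n :> R by rewrite exprn_gt0 ?ltr0n.
split; [by apply: coincide_pr_gt0; rewrite ?mass|
        by apply: coincide_pr_gt0; rewrite ?mass|].
move=> y; rewrite /marginal.
under eq_bigr do rewrite plantedE // mass //.
under [in RHS]eq_bigr do rewrite plantedE // mass //.
rewrite -!mulr_suml; congr (_ / _).
(* The indicator of the event [x = y] on [S] is the test function: it ignores coordinates outside
   [S]. *)
pose P (x : {ffun 'I_n -> Omega}) : R := [forall i, x (val i) == y i]%:R.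
have PE L : \sum_(x : {ffun 'I_n -> Omega} | [forall i, x (val i) == y i]) weight G L x
          = \sum_x P x * weight G L x.
  rewrite big_mkcond; apply: eq_bigr => x _; rewrite /P.
  by case: ifP; rewrite ?mul1r ?mul0r.
rewrite !PE; apply: weight_sum_cl => // x i a iS; rewrite /P; congr (_%:R).
congr (nat_of_bool _); apply: eq_forallb => j; rewrite upd_other //.
by apply: contraNneq iS => <-; apply: valP.
Qed.
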